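(* Let $(X,d)$ be a multiplicative metric space and let $f:X\to X$ be a multiplicative contraction, i.e. there is a real constant $\lambda\in[0,1)$ such that $d(f(x),f(y))\le d(x,y)^{\lambda}$ for all $x,y\in X$. If $(X,d)$ is complete, then $f$ has a unique fixed point.
   Context: A multiplicative metric on a nonempty set $X$ is a mapping $d:X\times X\to\mathbb{R}$ such that for all $x,y,z\in X$: (m1) $d(x,y)\ge 1$, and $d(x,y)=1$ if and only if $x=y$; (m2) $d(x,y)=d(y,x)$; (m3) $d(x,z)\le d(x,y)\cdot d(y,z)$. The pair $(X,d)$ is then called a multiplicative metric space. A sequence $(x_n)$ in $X$ is multiplicative convergent to $x\in X$ if for every $\varepsilon>1$ there is $N\in\mathbb{N}$ such that $d(x_n,x)<\varepsilon$ for all $n\ge N$. It is a multiplicative Cauchy sequence if for every $\varepsilon>1$ there is $N\in\mathbb{N}$ such that $d(x_m,x_n)<\varepsilon$ for all $m,n\ge N$. The space $(X,d)$ is complete if every multiplicative Cauchy sequence in $X$ is multiplicative convergent to some $x\in X$. *)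

(* Defs.v *)
From Stdlib Require Import Reals.
Local Open Scope R_scope.

Record mult_metric {X : Type} (d : X -> X -> R) : Prop := {
  mult_metric_nonempty : inhabited X;
  mult_metric_ge1 : forall x y, 1 <= d x y;
  mult_metric_eq1 : forall x y, d x y = 1 <-> x = y;
  mult_metric_sym : forall x y, d x y = d y x;
  mult_metric_triangle : forall x y z, d x z <= d x y * d y z
}.

Definition mult_converges {X : Type} (d : X -> X -> R) (u : nat -> X) (x : X) : Prop :=
  forall eps : R, 1 < eps ->
    exists N : nat, forall n : nat, (N <= n)%nat -> d (u n) x < eps.

Definition mult_cauchy {X : Type} (d : X -> X -> R) (u : nat -> X) : Prop :=
  forall eps : R, 1 < eps ->
    exists N : nat, forall m n : nat, (N <= m)%nat -> (N <= n)%nat -> d (u m) (u n) < eps.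

Definition mult_complete {X : Type} (d : X -> X -> R) : Prop :=
  forall u : nat -> X, mult_cauchy d u -> exists x : X, mult_converges d u x.

(* [Rpower a b] is [exp (b * ln a)], the real power of a positive base; here the
   base is at least 1 as soon as [d] is a multiplicative metric. In particular
   [Rpower a 0 = 1], so the case [lambda = 0] is the intended one. *)
Definition mult_contraction {X : Type} (d : X -> X -> R) (f : X -> X) : Prop :=
  exists lambda : R, 0 <= lambda < 1 /\
    forall x y : X, d (f x) (f y) <= Rpower (d x y) lambda.

(* Main.v *)
Require Import Defs.
From Stdlib Require Import Reals.
From Stdlib Require Import Lra.

(** The logarithm of a multiplicative metric is an ordinary metric, and it turns
    a multiplicative contraction with exponent [lambda] into an ordinary
    contraction with ratio [lambda], so the statement is Banach's fixed point
    theorem.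

    The triangle inequality along [x], [f x], [f y], [y] gives
    [(1 - lambda) * log_dist x y <= log_dist x (f x) + log_dist y (f y)]
    ([contraction_displacement]): two points that [f] moves little are close to
    each other.  Two fixed points are thus equal.  Along an orbit the
    displacement [log_dist u_n (f u_n)] decays like [lambda ^ n]
    ([orbit_displacement]), so the same inequality shows at once that the orbit
    is Cauchy, with no geometric series to sum ([orbit_cauchy]).  By
    completeness the orbit has a limit, and the limit of an orbit of a
    contraction is fixed ([orbit_limit_fixed]). *)

Local Open Scope R_scope.

Definition log_dist {X : Type} (d : X -> X -> R) (x y : X) : R := ln (d x y).

Lemma ln_le (a b : R) : 0 < a -> a <= b -> ln a <= ln b.
Proof.
  intros ha [hlt | ->]; [left; now apply ln_increasing | apply Rle_refl].
Qed.

Lemma log_dist_ge0 {X : Type} (d : X -> X -> R) (hd : mult_metric d) (x y : X) :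
  0 <= log_dist d x y.
Proof.
  unfold log_dist. pose proof (mult_metric_ge1 d hd x y) as h1.
  rewrite <- ln_1. apply ln_le; lra.
Qed.

Lemma log_dist_refl {X : Type} (d : X -> X -> R) (hd : mult_metric d) (x : X) :
  log_dist d x x = 0.
Proof.
  unfold log_dist. rewrite (proj2 (mult_metric_eq1 d hd x x) eq_refl).
  apply ln_1.
Qed.

Lemma log_dist_sym {X : Type} (d : X -> X -> R) (hd : mult_metric d) (x y : X) :
  log_dist d x y = log_dist d y x.
Proof. unfold log_dist. now rewrite (mult_metric_sym d hd). Qed.

Lemma log_dist_triangle {X : Type} (d : X -> X -> R) (hd : mult_metric d)
    (x y z : X) :
  log_dist d x z <= log_dist d x y + log_dist d y z.
Proof.
  unfold log_dist.
  pose proof (mult_metric_ge1 d hd x y) as hxy.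
  pose proof (mult_metric_ge1 d hd y z) as hyz.
  pose proof (mult_metric_ge1 d hd x z) as hxz.
  rewrite <- ln_mult by lra.
  apply ln_le; [lra | apply (mult_metric_triangle d hd)].
Qed.

Lemma log_dist_le0_eq {X : Type} (d : X -> X -> R) (hd : mult_metric d)
    (x y : X) :
  log_dist d x y <= 0 -> x = y.
Proof.
  intros hle. apply (mult_metric_eq1 d hd).
  pose proof (mult_metric_ge1 d hd x y) as h1.
  apply ln_inv; [lra | lra |].
  rewrite ln_1. apply Rle_antisym; [exact hle | now apply log_dist_ge0].
Qed.

Lemma dist_lt_log_dist {X : Type} (d : X -> X -> R) (hd : mult_metric d)
    (x y : X) (eps : R) :
  0 < eps -> d x y < eps <-> log_dist d x y < ln eps.
Proof.
  intros heps. unfold log_dist. pose proof (mult_metric_ge1 d hd x y) as h1.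
  split; intros h; [apply ln_increasing | apply ln_lt_inv]; lra.
Qed.

Definition log_contraction {X : Type} (d : X -> X -> R) (f : X -> X)
    (lambda : R) : Prop :=
  forall x y : X, log_dist d (f x) (f y) <= lambda * log_dist d x y.

Lemma log_contraction_of_mult {X : Type} (d : X -> X -> R) (f : X -> X)
    (lambda : R) (hd : mult_metric d) :
  (forall x y : X, d (f x) (f y) <= Rpower (d x y) lambda) ->
  log_contraction d f lambda.
Proof.
  intros hf x y. pose proof (mult_metric_ge1 d hd (f x) (f y)) as h1.
  unfold log_dist. rewrite <- (ln_exp (lambda * ln (d x y))).
  apply ln_le; [lra | apply hf].
Qed.

(** Going from [x] to [y] through [f x] and [f y] costs the two displacements
    plus at most [lambda * log_dist x y], which is absorbed on the left. *)
Lemma contraction_displacement {X : Type} (d : X -> X -> R) (f : X -> X)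
    (lambda : R) (hd : mult_metric d) (hf : log_contraction d f lambda)
    (x y : X) :
  (1 - lambda) * log_dist d x y <= log_dist d x (f x) + log_dist d y (f y).
Proof.
  pose proof (log_dist_triangle d hd x (f x) y) as h1.
  pose proof (log_dist_triangle d hd (f x) (f y) y) as h2.
  rewrite (log_dist_sym d hd (f y) y) in h2.
  pose proof (hf x y) as h3. lra.
Qed.

Lemma contraction_fixed_unique {X : Type} (d : X -> X -> R) (f : X -> X)
    (lambda : R) (hd : mult_metric d) (hl : lambda < 1)
    (hf : log_contraction d f lambda) (x y : X) :
  f x = x -> f y = y -> x = y.
Proof.
  intros hx hy. apply (log_dist_le0_eq d hd).
  pose proof (contraction_displacement d f lambda hd hf x y) as h.
  rewrite hx, hy in h.
  rewrite !(log_dist_refl d hd) in h. nra.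
Qed.

Lemma orbit_displacement {X : Type} (d : X -> X -> R) (f : X -> X)
    (lambda : R) (hl : 0 <= lambda) (hf : log_contraction d f lambda)
    (x : X) (n : nat) :
  log_dist d (Nat.iter n f x) (f (Nat.iter n f x))
    <= lambda ^ n * log_dist d x (f x).
Proof.
  induction n as [|n IH]; simpl; [lra |].
  eapply Rle_trans; [apply hf |].
  rewrite Rmult_assoc. now apply Rmult_le_compat_l.
Qed.

(** Late points of the orbit have small displacements, hence are close to one
    another by [contraction_displacement]. *)
Lemma orbit_cauchy {X : Type} (d : X -> X -> R) (f : X -> X)
    (lambda : R) (hd : mult_metric d) (hl : 0 <= lambda < 1)
    (hf : log_contraction d f lambda) (x : X) :
  mult_cauchy d (fun n => Nat.iter n f x).
Proof.
  intros eps heps.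
  set (C := log_dist d x (f x)).
  assert (hC : 0 <= C) by now apply log_dist_ge0.
  assert (hln : 0 < ln eps) by (rewrite <- ln_1; apply ln_increasing; lra).
  (* Each of the two displacements may use up half of [(1 - lambda) * ln eps];
     dividing by [C + 1] instead of [C] also covers [C = 0], a fixed starting point. *)
  set (delta := (1 - lambda) * ln eps / 2 / (C + 1)).
  assert (hdelta : 0 < delta).
  { unfold delta. repeat apply Rdiv_lt_0_compat; try lra.
    apply Rmult_lt_0_compat; lra. }
  assert (hdeltaC : delta * (C + 1) = (1 - lambda) * ln eps / 2)
    by (unfold delta; field; lra).
  destruct (pow_lt_1_zero lambda) with (y := delta) as [N hN];
    [rewrite Rabs_pos_eq; lra | exact hdelta |].
  assert (small : forall n, (N <= n)%nat ->
    log_dist d (Nat.iter n f x) (f (Nat.iter n f x))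
      < (1 - lambda) * ln eps / 2).
  { intros n hn.
    pose proof (orbit_displacement d f lambda (proj1 hl) hf x n) as h1.
    fold C in h1.
    pose proof (hN n hn) as h2.
    pose proof (pow_le lambda n (proj1 hl)) as h3.
    rewrite Rabs_pos_eq in h2 by exact h3.
    nra. }
  exists N. intros m n hm hn. apply (dist_lt_log_dist d hd); [lra |].
  pose proof (contraction_displacement d f lambda hd hf
    (Nat.iter m f x) (Nat.iter n f x)) as h.
  pose proof (small m hm) as h1. pose proof (small n hn) as h2.
  apply (Rmult_lt_reg_l (1 - lambda)); lra.
Qed.

(** Write [u] for the orbit and [y] for its limit.  The point [u (S n)] is close
    to [y] by convergence, and to [f y] because it is the image of [u n], so the
    displacement of [y] is below every positive number. *)
Lemma orbit_limit_fixed {X : Type} (d : X -> X -> R) (f : X -> X)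
    (lambda : R) (hd : mult_metric d) (hl : 0 <= lambda < 1)
    (hf : log_contraction d f lambda) (x y : X) :
  mult_converges d (fun n => Nat.iter n f x) y -> f y = y.
Proof.
  intros hy. symmetry. apply (log_dist_le0_eq d hd).
  apply le_epsilon. intros e he.
  destruct (hy (exp (e / 2))) as [N hN].
  { rewrite <- exp_0. apply exp_increasing. lra. }
  assert (close : forall n, (N <= n)%nat ->
    log_dist d (Nat.iter n f x) y < e / 2).
  { intros n hn. rewrite <- (ln_exp (e / 2)).
    apply (dist_lt_log_dist d hd); [apply exp_pos | now apply hN]. }
  pose proof (close N (le_n N)) as h1.
  pose proof (close (S N) (le_S _ _ (le_n N))) as h2. simpl in h2.
  pose proof (log_dist_triangle d hd y (f (Nat.iter N f x)) (f y)) as h3.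
  rewrite (log_dist_sym d hd y (f (Nat.iter N f x))) in h3.
  pose proof (hf (Nat.iter N f x) y) as h4.
  pose proof (log_dist_ge0 d hd (Nat.iter N f x) y) as h5.
  nra.
Qed.

Local Close Scope R_scope.

Theorem theorem3p2 (X : Type) (d : X -> X -> R) (f : X -> X)
    (hd : mult_metric d)
    (hf : mult_contraction d f)
    (hcomplete : mult_complete d) :
  exists! x : X, f x = x.
Proof.
  destruct hf as [lambda [hl hpow]].
  pose proof (log_contraction_of_mult d f lambda hd hpow) as hf.
  destruct (mult_metric_nonempty d hd) as [x0].
  destruct (hcomplete _ (orbit_cauchy d f lambda hd hl hf x0)) as [x hx].
  pose proof (orbit_limit_fixed d f lambda hd hl hf x0 x hx) as hfix.
  exists x. split; [exact hfix |].
  intros y hy. exact (contraction_fixed_unique d f lambda hd (proj2 hl) hf x y hfix hy).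
Qed.
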